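(* Let $m\ge 1$ be an integer, $\alpha\in(0,1)$, and $0<\delta<\lambda_1$, where $\lambda_1\le\dots\le\lambda_M$ are the eigenvalues of $\mathcal A_h$. Let $N$ be a positive integer, let $\mu(\lambda)$ be the number produced by the scalar geometrically refined recurrence described in the context, and, for $v\in V_h$, let $U_{L+1}\in V_h$ be the vector produced by the operator version of the recurrence started from $U_0=\delta^{-\alpha}v$. Then there is a constant $\widetilde c$ depending only on $\delta$, $m$ and $\alpha$ such that $$|\lambda^{-\alpha}-\mu(\lambda)|\le \widetilde c\,N^{-2m}\qquad\text{for all }\lambda\in[\lambda_1,\lambda_M]$$ and $$\|\mathcal A_h^{-\alpha}v-U_{L+1}\|\le \widetilde c\,N^{-2m}\,\|v\|\qquad\text{for all }v\in V_h .$$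
   Context: Setting. $\Omega\subset\mathbb R^d$ is a bounded domain with Lipschitz boundary, $V=H^1_0(\Omega)$, and $A(w,\phi)=\int_\Omega\big(a(x)\nabla w\cdot\nabla\phi+q(x)w\phi\big)\,dx$ is assumed bounded and coercive on $V$. $(\cdot,\cdot)$ and $\|\cdot\|$ are the $L^2(\Omega)$ inner product and norm. $V_h\subset V$ is a finite-dimensional (finite element) space of dimension $M$, and $\mathcal A_h:V_h\to V_h$ is the symmetric positive definite operator defined by $(\mathcal A_hw,\phi)=A(w,\phi)$ for all $w,\phi\in V_h$. Its eigenvalues are $0<\lambda_1\le\dots\le\lambda_M$ with $L^2(\Omega)$-orthonormal eigenvectors $\psi_1,\dots,\psi_M$, and $\mathcal A_h^{-\alpha}v=\sum_{j=1}^M\lambda_j^{-\alpha}(v,\psi_j)\psi_j$. $\mathcal I$ is the identity and $\mathcal B=\mathcal A_h-\delta\mathcal I$. Padé approximation. $r_m(x)=P_m(x)/Q_m(x)$ is the diagonal Padé approximation to $(1+x)^{-\alpha}$: $P_m,Q_m$ are the polynomials of degree $m$ with $Q_m(0)=1$ for which the first $2m+1$ Maclaurin terms (powers $x^0,\dots,x^{2m}$) of $(1+x)^{-\alpha}-r_m(x)$ vanish. Explicitly, $Q_m(x)=1+\sum_{j=1}^m a_jb_j(\alpha)x^j$ and $P_m(x)=1+\sum_{j=1}^m a_jb_j(-\alpha)x^j$, with $b_j(\alpha)=(m+\alpha)(m-1+\alpha)\cdots(m+1-j+\alpha)$ and $a_j=\dfrac{m(m-1)\cdots(m+1-j)}{j!\,(2m)(2m-1)\cdots(2m+1-j)}$.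 For an operator $X$ (symmetric with nonnegative spectrum), $r_m(X)=P_m(X)Q_m(X)^{-1}$. Geometrically refined mesh. $L=\lceil \log(\lambda_M)/\log 2\rceil$ (with $L\ge 0$), $t_0=0$, $t_i=2^{i-1-L}$ for $i=1,\dots,L+1$ (so $t_{L+1}=1$). For $n=1,\dots,L$ set $k_n=t_n/N$, and set $k_0=t_1/N$. Set $t_{n,j}=t_n+jk_n$ for $n=0,\dots,L$, $j=0,\dots,N$. Operator recurrence. Set $U_0=\delta^{-\alpha}v$. For $n=0,1,\dots,L$: set $U_{n,0}=U_n$; for $j=1,\dots,N$ set $U_{n,j}=r_m\big(k_n\mathcal B(\delta\mathcal I+t_{n,j-1}\mathcal B)^{-1}\big)U_{n,j-1}$; set $U_{n+1}=U_{n,N}$. Scalar recurrence (for given $\lambda$). Set $\mu_0=\delta^{-\alpha}$. For $n=0,1,\dots,L$: set $\mu_{n,0}=\mu_n$; for $j=1,\dots,N$ set $\mu_{n,j}=r_m\!\left(\dfrac{k_n(\lambda-\delta)}{\delta+t_{n,j-1}(\lambda-\delta)}\right)\mu_{n,j-1}$; set $\mu_{n+1}=\mu_{n,N}$. Finally $\mu(\lambda)=\mu_{L+1}$. *)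

(* Defs.v *)
From HB Require Import structures.
From mathcomp Require Import all_boot all_order all_algebra.
From mathcomp Require Import all_classical all_reals all_analysis.

Set Implicit Arguments.
Unset Strict Implicit.
Unset Printing Implicit Defensive.
Import Order.TTheory GRing.Theory Num.Theory.
Import numFieldNormedType.Exports.

Local Open Scope classical_set_scope.
Local Open Scope ring_scope.

(* R^n is 'rV[R]_n. Its sigma-algebra is generated by the coordinates (the
   same construction as the library's one on n.-tuple R), i.e. it is the Borel
   sigma-algebra. *)
Section rV_measurable.
Context {R : realType} (n : nat).

Definition rV_coord (i : 'I_n) (x : 'rV[R]_n) : measurableTypeR R := x ord0 i.

Let set0m : g_sigma_preimage rV_coord set0.
Proof. exact: sigma_algebra0. Qed.

Let setCm A : g_sigma_preimage rV_coord A -> g_sigma_preimage rV_coord (~` A).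
Proof. exact: sigma_algebraC. Qed.

Let bigcupm (F : _^nat) : (forall i, g_sigma_preimage rV_coord (F i)) ->
  g_sigma_preimage rV_coord (\bigcup_i (F i)).
Proof. exact: sigma_algebra_bigcup. Qed.

HB.instance Definition _ := @isMeasurable.Build default_measure_display
  'rV[R]_n (g_sigma_preimage rV_coord) set0m setCm bigcupm.
End rV_measurable.

Lemma measurable_rV_coord (R : realType) n (i : 'I_n) :
  measurable_fun [set: 'rV[R]_n] (@rV_coord R n i).
Proof.
move=> _ Y mY; rewrite setTI; apply: sub_sigma_algebra => /=.
rewrite -bigcup_seq/=; exists i => /=; first by rewrite mem_index_enum.
by exists Y => //; rewrite setTI.
Qed.

Section lebesgue_rV.
Context {R : realType}.

Definition rV_cons n (p : measurableTypeR R * 'rV[R]_n) : 'rV[R]_n.+1 :=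
  row_mx (p.1 : R)%:M p.2.

Lemma measurable_rV_cons n : measurable_fun setT (@rV_cons n).
Proof.
suff: g_sigma_preimage (fun i => @rV_coord R n.+1 i \o @rV_cons n) `<=`
    measurable.
  rewrite g_sigma_preimage_comp => H _ Y mY; apply: H; exists Y => //.
apply: smallest_sub; first exact: sigma_algebra_measurable.
rewrite -bigcup_mkord_ord; apply: bigcup_sub => i Ii A [B mB <-].
suff H j : measurable_fun setT (@rV_coord R n.+1 j \o @rV_cons n).
  exact: H.
have [j0|j0] := split_ordP (j : 'I_(1 + n)).
  move=> ->; rewrite (_ : _ \o _ = fst); first exact: measurable_fst.
  apply/funext => p; rewrite /comp /rV_coord /rV_cons.
  by apply: etrans (row_mxEl _ _ _ _) _; rewrite mxE (ord1 j0) mulr1n.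
move=> ->; rewrite (_ : _ \o _ = @rV_coord R n j0 \o snd); last first.
  by apply/funext => p; exact: row_mxEr.
exact: measurableT_comp (@measurable_rV_coord R n j0) measurable_snd.
Qed.

Section cons_measure.
Variables (n : nat) (mu : {measure set 'rV[R]_n -> \bar R}).

Definition cons_measure : set 'rV[R]_n.+1 -> \bar R :=
  pushforward (lebesgue_measure \x^ mu)%E (@rV_cons n).

Let mcons := @measurable_rV_cons n.

Let cons_measure0 : cons_measure set0 = 0%E.
Proof. exact: measure0. Qed.

Let cons_measure_ge0 A : (0 <= cons_measure A)%E.
Proof. exact: measure_ge0. Qed.

Let cons_measure_sigma_additive : semi_sigma_additive cons_measure.
Proof. exact: measure_semi_sigma_additive. Qed.

HB.instance Definition _ := isMeasure.Build _ _ _ cons_measure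
  cons_measure0 cons_measure_ge0 cons_measure_sigma_additive.
End cons_measure.

(* Lebesgue measure on R^n: Dirac mass for n = 0, and the image of the product
   of the one-dimensional Lebesgue measure and lebesgue_rV n for n + 1. *)
Fixpoint lebesgue_rV n : {measure set 'rV[R]_n -> \bar R} :=
  match n with
  | 0 => dirac (0 : 'rV[R]_0)
  | n'.+1 => cons_measure (lebesgue_rV n')
  end.

End lebesgue_rV.

Section sobolev.
Context {R : realType} (d : nat).
Local Notation Rd := 'rV[R]_d.+1.
Implicit Types (Omega : set Rd) (f w phi : Rd -> R).

(* Near a boundary point, and up to an orthogonal change of coordinates x *m T,
   Omega is the region strictly above the graph of a Lipschitz function of the
   last d coordinates. *)
Definition lipschitz_boundary Omega := forall x0,
  (closure Omega `\` Omega) x0 ->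
  exists (r k : R) (T : 'M[R]_d.+1) (gam : 'rV[R]_d -> R),
    [/\ 0 < r, T *m T^T = 1%:M,
        forall y z, `|gam y - gam z| <= k * `|y - z| &
        forall x, ball x0 r x ->
          (Omega x <-> gam (col' ord0 (x *m T)) < (x *m T) ord0 ord0)].

Definition bounded_lipschitz_domain Omega :=
  [/\ Omega !=set0, open Omega, connected Omega, bounded_set Omega &
      lipschitz_boundary Omega].

Definition L2 Omega f := measurable_fun Omega f /\
  (lebesgue_rV d.+1).-integrable Omega (fun x => (f x ^+ 2)%:E).

Definition L2dot Omega f (g : Rd -> R) : R := \int[lebesgue_rV d.+1]_(x in Omega) (f x * g x).

Definition L2norm Omega f : R := Num.sqrt (L2dot Omega f f).

Definition partial (i : 'I_d.+1) f : Rd -> R :=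
  fun x => 'D_(delta_mx ord0 i) f x.

Definition smooth f :=
  forall (s : seq 'I_d.+1) (x : Rd), differentiable (foldr partial f s) x.

Definition test_function Omega phi := smooth phi /\
  exists K : set Rd, [/\ compact K, K `<=` Omega & forall x, ~ K x -> phi x = 0].

Definition weak_gradient Omega w (g : Rd -> Rd) :=
  (forall i, L2 Omega (fun x => g x ord0 i)) /\
  forall i phi, test_function Omega phi ->
    L2dot Omega w (partial i phi) = - L2dot Omega (fun x => g x ord0 i) phi.

(* Weak gradients are determined up to a null set; grad selects one. *)
Definition grad Omega w : Rd -> Rd := xget (fun=> 0) [set g | weak_gradient Omega w g].

Definition H1 Omega w := L2 Omega w /\ exists g, weak_gradient Omega w g.

Definition H1norm Omega w : R := Num.sqrt (L2dot Omega w w +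
  \sum_i L2dot Omega (fun x => grad Omega w x ord0 i)
                     (fun x => grad Omega w x ord0 i)).

(* The closure of the test functions in H1. *)
Definition H10 Omega w := H1 Omega w /\
  exists phi_ : nat -> Rd -> R, (forall k, test_function Omega (phi_ k)) /\
    (H1norm Omega (fun x => w x - phi_ k x) @[k --> \oo] --> (0 : R)).

Section form.
Variables (Omega : set Rd) (a : Rd -> 'M[R]_d.+1) (q : Rd -> R).

(* Gradients are row vectors: the first term is (a grad w) . grad phi. *)
Definition form_integrand w phi (x : Rd) : R :=
  (grad Omega w x *m (a x)^T *m (grad Omega phi x)^T) ord0 ord0
  + q x * w x * phi x.

Definition form w phi : R :=
  \int[lebesgue_rV d.+1]_(x in Omega) form_integrand w phi x.

Definition symmetric_coef := forall x, Omega x -> (a x)^T = a x.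

Definition measurable_coef :=
  (forall i j, measurable_fun Omega (fun x => a x i j)) /\
  measurable_fun Omega q.

(* Boundedness includes that the integral defining the form converges. *)
Definition bounded_form := exists C : R, forall w phi,
  H10 Omega w -> H10 Omega phi ->
  (lebesgue_rV d.+1).-integrable Omega (fun x => (form_integrand w phi x)%:E) /\
  `|form w phi| <= C * H1norm Omega w * H1norm Omega phi.

Definition coercive_form := exists2 C : R, 0 < C &
  forall w, H10 Omega w -> C * H1norm Omega w ^+ 2 <= form w w.

End form.

(* A finite-dimensional subspace of H10, given by a linear choice iota of
   representatives; the last condition says that iota stays injective after
   identifying functions equal almost everywhere. *)
Definition subspace_of_H10 Omega (Vh : vectType R)
    (iota : {linear Vh -> (Rd -> R^o)}) :=
  (forall v, H10 Omega (iota v)) /\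
  (forall v, L2norm Omega (iota v) = 0 -> v = 0).

End sobolev.

Section discrete.
Context {R : realType} (d : nat) (Omega : set 'rV[R]_d.+1).
Variables (Vh : vectType R) (iota : {linear Vh -> ('rV[R]_d.+1 -> R^o)}).

Definition hdot (v w : Vh) : R := L2dot Omega (iota v) (iota w).

Definition hnorm (v : Vh) : R := L2norm Omega (iota v).

(* Ah is the operator induced on Vh by the form. *)
Definition discrete_operator (a : 'rV[R]_d.+1 -> 'M[R]_d.+1)
    (q : 'rV[R]_d.+1 -> R) (Ah : 'End(Vh)) :=
  forall w phi, hdot (Ah w) phi = form Omega a q (iota w) (iota phi).

(* The dimension M is written M.+1, so that the first and last eigenvalues are
   lam ord0 and lam ord_max. *)
Definition eigensystem (M : nat) (Ah : 'End(Vh))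
    (lam : 'I_M.+1 -> R) (psi : 'I_M.+1 -> Vh) :=
  [/\ \dim {:Vh} = M.+1,
      forall i j : 'I_M.+1, (i <= j)%N -> lam i <= lam j,
      forall j, Ah (psi j) = lam j *: psi j &
      forall i j, hdot (psi i) (psi j) = (i == j)%:R].

(* fractional_power lam psi s v is Ah^s v *)
Definition fractional_power (M : nat) (lam : 'I_M.+1 -> R)
    (psi : 'I_M.+1 -> Vh) (s : R) (v : Vh) : Vh :=
  \sum_j (lam j `^ s * hdot v (psi j)) *: psi j.

End discrete.

Section pade.
Context {R : realType}.

Definition diagonal_pade (m : nat) (alpha : R) (P Q : {poly R}) :=
  [/\ size P = m.+1, size Q = m.+1, Q.[0] = 1 &
      forall k, (k <= 2 * m)%N ->
        derive1n k (fun x : R => (1 + x) `^ (- alpha) - P.[x] / Q.[x]) 0 = 0].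

Definition rational_op (Vh : vectType R) (P Q : {poly R}) (X : 'End(Vh)) :
    'End(Vh) :=
  let ev (p : {poly R}) : 'End(Vh) :=
    \sum_(i < size p) p`_i *: iter i (comp_lfun X) \1%VF in
  (ev P \o (ev Q)^-1)%VF.

End pade.

Section refined.
Context {R : realType}.

(* max(0, ceil(log_2 lamM)) *)
Definition mesh_levels (lamM : R) : nat :=
  absz (Num.max 0 (Num.ceil (ln lamM / ln 2))).

Definition mesh_t (L i : nat) : R :=
  if i == 0%N then 0 else 2 ^ (i%:Z - 1 - L%:Z).

Definition mesh_k (L N n : nat) : R :=
  (if n == 0%N then mesh_t L 1%N else mesh_t L n) / N%:R.

Definition mesh_tj (L N n j : nat) : R := mesh_t L n + j%:R * mesh_k L N n.

(* Runs n = 0, ..., L and, for each n, j = 0, ..., N - 1, applying step n j to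
   the current value: step n j maps U_{n,j} to U_{n,j+1}. *)
Definition refined_run (T : Type) (L N : nat) (step : nat -> nat -> T -> T)
    (u0 : T) : T :=
  iteri L.+1 (fun n => iteri N (step n)) u0.

Definition scalar_recurrence (alpha delta : R) (P Q : {poly R}) (L N : nat)
    (l : R) : R :=
  refined_run L N (fun n j mu =>
    let x := mesh_k L N n * (l - delta)
             / (delta + mesh_tj L N n j * (l - delta)) in
    P.[x] / Q.[x] * mu) (delta `^ (- alpha)).

Definition operator_recurrence (Vh : vectType R) (Ah : 'End(Vh))
    (alpha delta : R) (P Q : {poly R}) (L N : nat) (v : Vh) : Vh :=
  let B : 'End(Vh) := Ah - delta *: \1%VF in
  refined_run L N (fun n j U =>
    rational_op P Q
      (mesh_k L N n *: (B \o (delta *: \1 + mesh_tj L N n j *: B)^-1)%VF) U)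
    (delta `^ (- alpha) *: v).

End refined.

(* Main.v *)
Require Import Defs.
From mathcomp Require Import all_boot all_order all_algebra.
From mathcomp Require Import all_classical all_reals all_analysis.
From mathcomp Require Import measurable_realfun.
From mathcomp Require Import ring lra.
Import Order.TTheory GRing.Theory Num.Theory.
Import numFieldNormedType.Exports.
Local Open Scope classical_set_scope.
Local Open Scope ring_scope.

Set Implicit Arguments.
Unset Strict Implicit.

(** Write y(t) = (delta + t (l - delta))^-alpha, so that y(0) = delta^-alpha
    and y(1) = l^-alpha.  One step of size k at t multiplies y by
    rho(x) = (1 + x)^-alpha and multiplies the computed value by
    r(x) = P(x) / Q(x), where x = k (l - delta) / (delta + t (l - delta)).
    The geometric mesh is designed so that every x is at most X / N with
    X = 1 + 1/delta, whatever l in (delta, 2^L] is.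

    Two facts about r suffice.  It is a contraction, 0 <= r <= 1 on [0, oo),
    and it satisfies |rho(x) - r(x)| <= K x^(2m) (1 - rho(x)) on [0, X]
    (pade_step): the approximation order gives O(x^(2m+1)), and 1 - rho(x) is
    at least a multiple of x.  With E = K (X/N)^(2m), one step then adds at
    most E (1 - rho) y, which is E times the decrease of y over that step.
    These decreases telescope, so that
      |y(t) - mu(t)| <= E (y(0) - y(t))
    holds along the whole run: the bound involves neither the number of levels
    nor l (scalar_recurrence_error).

    For the facts about r, expand Q in powers of 1 + x.  If Q f - P vanishes to
    order 2m+1 at 0 and f solves (1+x) f' = s f, then differentiating m+1 times
    removes P and multiplies the coefficient of (1+x)^i by the product of the
    m+1 numbers s + i - j, j = 0, ..., m; the result vanishes to order m and has
    degree at most m, so it is a multiple of x^m.  Reading off the coefficients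
    determines Q (pade_den_uniq), and shows that with s = -alpha they all have
    one sign.
    Since 1/f solves the equation with -s, the same computation gives P, whose
    coefficients are those of Q in reverse order.  Positivity of the
    coefficients gives Q >= 1 and P >= 1 on [0, oo), and comparing them in
    pairs gives P <= Q (pade_den_le).

    The operator recurrence is diagonal in the eigenbasis psi and acts on each
    psi_i as the scalar recurrence with l = lam_i, so the second estimate
    follows from the first by Parseval. *)

(** * Pade approximants of a solution of a first-order equation *)

Lemma dvdXnP (F : fieldType) (n : nat) (p : {poly F}) :
  reflect (forall i, (i < n)%N -> p`_i = 0) ('X^n %| p)%R.
Proof.
apply: (iffP idP) => [/dvdpP[q ->] i lt_in|p0]; first by rewrite coefMXn lt_in.
rewrite -(poly_take_drop n p) (_ : take_poly n p = 0) ?add0r ?dvdp_mulIr//.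
by apply/polyP => i; rewrite coef_take_poly coef0; case: ifP => // /p0.
Qed.

Lemma dvdp_exp_deriv (F : fieldType) (a p : {poly F}) (n : nat) :
  (a ^+ n.+1 %| p -> a ^+ n %| p^`())%R.
Proof.
case/dvdpP => q ->; rewrite derivM deriv_exp /= -mulr_natr.
apply: dvdp_add; first by rewrite exprS mulrA dvdp_mulIr.
by rewrite [X in q * X]mulrAC mulrA dvdp_mulIr.
Qed.

Section shifted_pade.
Variables (F : fieldType) (s : F).

(** The factor l < k of the product is the action of X d/dX + (s - l) on X^i:
    after k derivatives of q f, with X f' = s f, the cofactor of X^-k f is
    euler_iter k q. *)
Definition euler_iter (m k : nat) (q : {poly F}) : {poly F} :=
  \poly_(i < m.+1) ((\prod_(l < k) (i%:R + s - l%:R)) * q`_i).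

(** With A_k = q_k T - X^k p^(k), divisibility of A_k by a^(n-k) passes from k
    to k + 1 because differentiation costs one power of a, and X A_k' - k A_k
    is A_(k+1) up to a multiple of the residual of the equation for T. *)
Lemma euler_iter_dvd (n m : nat) (T p q : {poly F}) (a := 'X - 1%:P : {poly F}) :
  (size q <= m.+1)%N ->
  (a ^+ n.-1 %| 'X * T^`() - s *: T)%R -> (a ^+ n %| q * T - p)%R ->
  forall k, (k <= n)%N ->
    (a ^+ (n - k) %| euler_iter m k q * T - 'X^k * p^`(k))%R.
Proof.
move=> sq aT aqp; elim=> [_|k IHk lt_kn].
  rewrite subn0 expr0 mul1r derivn0 (_ : euler_iter m 0 q = q)//.
  apply/polyP => i; rewrite coef_poly big_ord0 mul1r.
  by case: ltnP => // /(leq_trans sq)/leq_sizeP->.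
have {IHk} := IHk (ltnW lt_kn); set A := (_ - _) => aA.
have -> : euler_iter m k.+1 q * T - 'X^(k.+1) * p^`(k.+1) =
    'X * A^`() - k%:R *: A + euler_iter m k q * (s *: T - 'X * T^`()).
  have -> : euler_iter m k.+1 q = 'X * (euler_iter m k q)^`()
       + (s - k%:R) *: euler_iter m k q.
    apply/polyP => i; rewrite coefD coefXM coefZ.
    case: i => [|i]; rewrite ?coef_deriv !coef_poly.
      by rewrite /= big_ord_recr/=; ring.
    case: ifP => _; last by rewrite mul0rn mulr0 addr0.
    by rewrite big_ord_recr /= -mulr_natl; ring.
  rewrite /A derivB !derivM derivXn derivnS -!mul_polyC rmorphB/=.
  rewrite -['X^_ *+ k]mulr_natl !polyC_natr; case: k {lt_kn A aA} => [|k].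
    by rewrite expr0 mulr0n; ring.
  by rewrite [k.+1.-1]/= ['X^(k.+1)]exprS ['X^(k.+2)]exprS ['X^(k.+1)]exprS; ring.
have lt_nk : (n - k)%N = (n - k.+1).+1 by rewrite subnSK.
apply: dvdp_add; last first.
  rewrite dvdp_mull// -dvdpNr opprB (dvdp_trans _ aT)// dvdp_exp2l//.
  by case: n lt_kn {aqp aT aA lt_nk} => //= n; rewrite subSS leq_subr.
rewrite dvdp_sub// ?dvdp_mull ?dvdp_exp_deriv -?lt_nk//.
by rewrite -mul_polyC dvdp_mull// (dvdp_trans _ aA)// dvdp_exp2l// leq_sub2l.
Qed.

(** After m + 1 derivatives p has disappeared, and what is left of q is a
    polynomial of degree at most m divisible by (X - 1)^m. *)
Lemma shifted_pade_coef (m : nat) (T p q : {poly F}) (a := 'X - 1%:P : {poly F}) :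
  (size q <= m.+1)%N -> (size p <= m.+1)%N -> T.[1] != 0 ->
  (a ^+ (2 * m) %| 'X * T^`() - s *: T)%R -> (a ^+ (2 * m).+1 %| q * T - p)%R ->
  exists c : F, forall i, (i <= m)%N ->
    (\prod_(l < m.+1) (i%:R + s - l%:R)) * q`_i = c * (-1) ^+ (m - i) *+ 'C(m, i).
Proof.
move=> sq sp T1 aT aqp.
have := @euler_iter_dvd (2 * m).+1 m T p q sq aT aqp m.+1.
have sE : (size (euler_iter m m.+1 q) <= m.+1)%N by exact: size_poly.
rewrite derivn_poly0// mulr0 subr0 subSS mul2n -addnn ltnS leq_addr addnK.
move=> /(_ isT); rewrite Gauss_dvdpl; last first.
  by rewrite coprimep_expl// coprimep_sym coprimep_XsubC.
case/dvdpP => r rE; exists r`_0 => i le_im.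
have rC : r = (r`_0)%:P.
  apply: size1_polyC; have [->|r0] := eqVneq r 0; first by rewrite size_poly0.
  have a0 : a ^+ m != 0 by rewrite expf_neq0 ?polyXsubC_eq0.
  move: sE; rewrite rE size_mul// size_exp_XsubC addnS/= -[m.+1]add1n.
  by rewrite leq_add2r.
have := congr1 (coefp i) rE; rewrite /= coef_poly ltnS le_im => ->.
have -> : a ^+ m = \poly_(i < m.+1) ((-1) ^+ (m - i) *+ 'C(m, i)).
  rewrite /a -polyCN addrC exprDn poly_def; apply: eq_bigr => j _.
  by rewrite -polyC_exp -scalerMnl -mul_polyC.
by rewrite {1}rC mul_polyC coefZ coef_poly ltnS le_im mulrnAr.
Qed.
End shifted_pade.

(** * The explicit diagonal Pade approximant of a power of 1 + x *)

Section explicit_pade.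
Variable F : realFieldType.
Implicit Types (s alpha : F) (P Q : {poly F}).

Definition binpoly s n : {poly F} :=
  \poly_(k < n.+1) ((\prod_(l < k) (s - l%:R)) / k`!%:R).

Lemma binpoly_at0 s n : (binpoly s n).[0] = 1.
Proof. by rewrite horner_coef0 coef_poly big_ord0 fact0 divr1. Qed.

Lemma binpoly_ode s n :
  ('X^n %| (1 + 'X) * (binpoly s n)^`() - s *: binpoly s n)%R.
Proof.
apply/dvdXnP => i lt_in.
have recE k : (k < n)%N ->
    (binpoly s n)`_k.+1 *+ k.+1 = (s - k%:R) * (binpoly s n)`_k.
  move=> lt_kn; rewrite !coef_poly !ltnS lt_kn (ltnW lt_kn) big_ord_recr /=.
  have f0 : k`!%:R != 0 :> F by rewrite pnatr_eq0 -lt0n fact_gt0.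
  by rewrite factS natrM -mulr_natr; field; rewrite f0 nat1r pnatr_eq0.
rewrite coefB mulrDl mul1r coefD coefXM coefZ !coef_deriv recE//.
case: i lt_in => [|i] lt_in /=; first by ring.
by rewrite -[_ *+ i.+1]mulr_natr; ring.
Qed.

Lemma dvdXn_primitive n (p : {poly F}) :
  p`_0 = 0 -> ('X^n %| p^`())%R -> ('X^(n.+1) %| p)%R.
Proof.
move=> p0 /dvdXnP dp; apply/dvdXnP => -[//|i]; rewrite ltnS => /dp/eqP.
by rewrite coef_deriv mulrn_eq0 => /eqP.
Qed.

(** The product W satisfies (1 + X) W' = 0 up to X^n, as the two equations
    cancel, so only its constant term survives. *)
Lemma binpoly_inv s n : ('X^(n.+1) %| binpoly s n * binpoly (- s) n - 1)%R.
Proof.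
apply: dvdXn_primitive.
  by rewrite -horner_coef0 !hornerE !binpoly_at0 mulr1 subrr.
rewrite -(@Gauss_dvdpr _ _ (1 + 'X)); last first.
  by rewrite coprimep_expl// coprimep_sym coprimepX /root !hornerE oner_eq0.
have -> : (1 + 'X) * (binpoly s n * binpoly (- s) n - 1)^`() =
  ((1 + 'X) * (binpoly s n)^`() - s *: binpoly s n) *
  binpoly (- s) n + binpoly s n *
  ((1 + 'X) * (binpoly (- s) n)^`() - (- s) *: binpoly (- s) n).
  by rewrite derivB derivM derivC -!mul_polyC polyCN; ring.
by apply: dvdp_add; [rewrite dvdp_mulr|rewrite dvdp_mull]; rewrite ?binpoly_ode.
Qed.

Definition rising alpha n : F := \prod_(k < n) (k.+1%:R + alpha).

Definition pade_weight m alpha i : F :=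
  'C(m, i)%:R / (rising (- alpha) i * rising alpha (m - i)).

(** This is the denominator, and by the symmetry between (1 + x)^-alpha and its
    inverse the numerator is [pade_den m (- alpha)]. *)
Definition pade_den m alpha : {poly F} :=
  (\sum_(i < m.+1) pade_weight m alpha i)^-1 *:
    \sum_(i < m.+1) pade_weight m alpha i *: (1 + 'X) ^+ i.

Lemma rising_gt0 alpha n : -1 < alpha -> 0 < rising alpha n.
Proof.
move=> ha; apply: prodr_gt0 => i _; rewrite -natr1.
by have := ler0n F i; lra.
Qed.

Lemma pade_weight_gt0 m alpha i : -1 < alpha < 1 -> (i <= m)%N ->
  0 < pade_weight m alpha i.
Proof.
move=> ha le_im; rewrite divr_gt0 ?ltr0n ?bin_gt0// mulr_gt0// rising_gt0; lra.
Qed.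

(** The factors with l < i make up rising (- alpha) i, the one with l = i is
    - alpha, and those with l > i make up rising alpha (m - i) up to sign.  That
    alternating sign is the one of the coefficients of (X - 1)^m, which is why
    the coefficients of the approximant all have the same sign. *)
Lemma prod_descending m alpha i : (i <= m)%N ->
  \prod_(l < m.+1) (i%:R - alpha - l%:R) =
  (-1) ^+ (m - i) * - alpha * (rising (- alpha) i * rising alpha (m - i)).
Proof.
move=> le_im; rewrite -(big_mkord xpredT (fun l => i%:R - alpha - l%:R)).
rewrite (big_cat_nat (n := i))//= ?leqW// big_nat_rev/= add0n.
rewrite (big_ltn (m := i)) ?ltnS// -[i.+1]add0n big_addn subSS.
rewrite (eq_big_nat _ _ (F2 := fun l => l.+1%:R - alpha)); last first.
  by move=> l /andP[_ lt_li]; rewrite subnS -subnSK ?natrB//=; ring.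
rewrite [X in _ * (_ * X)](eq_bigr (fun l => - (l.+1%:R + alpha))); last first.
  by move=> l _; rewrite addnS -natr1 natrD -natr1; ring.
rewrite !big_mkord prodrN card_ord /rising; ring.
Qed.

(** The substitution of X - 1 for X turns the expansion in powers of 1 + x into
    the usual coefficients, which [shifted_pade_coef] determines up to a
    constant factor; Q(0) = 1 fixes that factor.  The sign of alpha is left
    free so that the numerator is covered too. *)
Lemma pade_den_uniq m alpha P Q : -1 < alpha < 1 -> alpha != 0 ->
  (size P <= m.+1)%N -> (size Q <= m.+1)%N -> Q.[0] = 1 ->
  ('X^((2 * m).+1) %| Q * binpoly (- alpha) (2 * m) - P)%R ->
  Q = pade_den m alpha.
Proof.
move=> ha a0 sP sQ Q0 QP; set T := binpoly _ _ in QP.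
pose sh (p : {poly F}) : {poly F} := p \Po ('X - 1%:P : {poly F}).
have shXn n p : ('X^n %| p)%R -> (('X - 1%:P) ^+ n %| sh p)%R.
  by move=> /(dvdp_comp_poly ('X - 1%:P)); rewrite rmorphXn/= comp_polyX.
have szX : size ('X - 1%:P : {poly F}) = 2 by rewrite size_XsubC.
have szsh (p : {poly F}) : (size p <= m.+1)%N -> (size (sh p) <= m.+1)%N.
  by rewrite size_comp_poly2.
have T1 : (sh T).[1] != 0.
  by rewrite horner_comp !hornerE subrr binpoly_at0 oner_eq0.
have odeT : (('X - 1%:P) ^+ (2 * m) %| 'X * (sh T)^`() - - alpha *: sh T)%R.
  have := shXn _ _ (binpoly_ode (- alpha) (2 * m)).
  have shX : sh (1 + 'X) = 'X.
    by rewrite /sh comp_polyD comp_polyX -polyC1 comp_polyC addrC subrK.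
  have shT' : sh T^`() = (sh T)^`().
    by rewrite /sh deriv_comp derivB derivX derivC subr0 mulr1.
  by rewrite /sh comp_polyB comp_polyM comp_polyZ -/sh -!/(sh _) shX shT'.
have := shXn _ _ QP; rewrite {1}/sh comp_polyB comp_polyM => QPsh.
have [c cE] := shifted_pade_coef (szsh _ sQ) (szsh _ sP) T1 odeT QPsh.
have coefQ i : (i <= m)%N -> (sh Q)`_i = - (c / alpha) * pade_weight m alpha i.
  move=> le_im; have := cE i le_im; rewrite prod_descending// -mulr_natr => E.
  have r1 : rising (- alpha) i != 0 by rewrite gt_eqF// rising_gt0; lra.
  have r2 : rising alpha (m - i) != 0 by rewrite gt_eqF// rising_gt0; lra.
  apply: (@mulfI _ ((-1) ^+ (m - i) * - alpha *
      (rising (- alpha) i * rising alpha (m - i)))).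
    by rewrite !mulf_neq0 ?oppr_eq0// expf_neq0// oppr_eq0 oner_eq0.
  by rewrite E /pade_weight; field; rewrite r1 r2.
have QE : Q = - (c / alpha) *:
    \sum_(i < m.+1) pade_weight m alpha i *: (1 + 'X) ^+ i.
  have -> : Q = sh Q \Po ('X + 1%:P).
    by rewrite /sh -comp_polyA comp_polyB comp_polyX comp_polyC addrK comp_polyXr.
  have -> : sh Q = \poly_(i < m.+1) (- (c / alpha) * pade_weight m alpha i).
    apply/polyP => i; rewrite coef_poly ltnS; case: leqP => [/coefQ//|lt_mi].
    by move/leq_sizeP: (szsh _ sQ); apply.
  rewrite poly_def raddf_sum scaler_sumr; apply: eq_bigr => i _ /=.
  by rewrite comp_polyZ rmorphXn/= comp_polyX scalerA addrC.
rewrite {1}QE /pade_den; congr (_ *: _).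
have := congr1 (horner ^~ 0) QE; rewrite hornerZ Q0 horner_sum.
rewrite (eq_bigr (fun i : 'I__ => pade_weight m alpha i)) => [E|i _]; last first.
  by rewrite !hornerE expr1n ?mulr1.
have S0 : \sum_(i < m.+1) pade_weight m alpha i != 0.
  by apply/eqP => S0; move: E; rewrite S0 mulr0 => /eqP; rewrite oner_eq0.
by apply: (mulIf S0); rewrite -E mulVf.
Qed.

End explicit_pade.

Section pade_bounds.
Variable F : realFieldType.
Implicit Types (alpha x : F) (P Q : {poly F}).

Lemma pade_weightN m alpha i : (i <= m)%N ->
  pade_weight m (- alpha) i = pade_weight m alpha (m - i).
Proof.
by move=> le_im; rewrite /pade_weight opprK subKn// bin_sub// [X in _ / X]mulrC.
Qed.

(** Passing from j to j + d multiplies the two sides by the k - alpha and the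
    k + alpha respectively. *)
Lemma rising_swap alpha j d : 0 <= alpha < 1 ->
  rising (- alpha) (j + d) * rising alpha j <=
  rising (- alpha) j * rising alpha (j + d).
Proof.
move=> ha; elim: d => [|d IHd]; first by rewrite addn0 mulrC.
have jd0 := ler0n F (j + d).
rewrite addnS /rising !big_ord_recr/= -!/(rising _ _) [leLHS]mulrAC mulrA.
rewrite ler_pM//; last by rewrite -natr1; lra.
- by rewrite mulr_ge0// ltW// rising_gt0; lra.
- by rewrite -natr1; lra.
Qed.

Lemma pade_weight_mono m alpha i : 0 <= alpha < 1 -> (i <= m)%N ->
  (m - i <= i)%N -> pade_weight m alpha (m - i) <= pade_weight m alpha i.
Proof.
move=> ha le_im le_mi; rewrite /pade_weight subKn// bin_sub//.
have h1 n : 0 < rising alpha n by apply: rising_gt0; lra.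
have h2 n : 0 < rising (- alpha) n by apply: rising_gt0; lra.
rewrite ler_wpM2l// lef_pV2 ?posrE ?mulr_gt0//.
by have := rising_swap (m - i) (i - (m - i)) ha; rewrite subnKC.
Qed.

Lemma pade_den_horner m alpha x : (pade_den m alpha).[x] =
  (\sum_(i < m.+1) pade_weight m alpha i)^-1 *
  \sum_(i < m.+1) pade_weight m alpha i * (1 + x) ^+ i.
Proof.
rewrite hornerZ horner_sum; congr (_ * _); apply: eq_bigr => i _.
by rewrite !hornerE.
Qed.

Lemma sum_pade_weight_gt0 m alpha : -1 < alpha < 1 ->
  0 < \sum_(i < m.+1) pade_weight m alpha i.
Proof.
move=> ha; rewrite big_ord_recl ltr_pwDl ?pade_weight_gt0//.
by rewrite sumr_ge0// => i _; rewrite ltW// pade_weight_gt0// -ltnS.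
Qed.

Lemma pade_den_ge1 m alpha x : -1 < alpha < 1 -> 0 <= x ->
  1 <= (pade_den m alpha).[x].
Proof.
move=> ha x0; rewrite pade_den_horner ler_pdivlMl ?sum_pade_weight_gt0// mulr1.
apply: ler_sum => i _; rewrite ler_peMr ?exprn_ege1 ?lerDl//.
by rewrite ltW// pade_weight_gt0// -ltnS.
Qed.

(** With z = 1 + x, twice the difference is the sum over i of
    (w_i - w_(m-i)) (z^i - z^(m-i)), and both factors are nonnegative for
    i >= m - i and nonpositive otherwise. *)
Lemma pade_den_le m alpha x : 0 <= alpha < 1 -> 0 <= x ->
  (pade_den m (- alpha)).[x] <= (pade_den m alpha).[x].
Proof.
move=> ha x0; have ha' : -1 < alpha < 1 by lra.
have revE (f : nat -> F) :
    \sum_(i < m.+1) f i = \sum_(i < m.+1) f (m - i)%N.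
  by rewrite (reindex_inj rev_ord_inj); apply: eq_bigr => i _ /=; rewrite subSS.
have le_im (i : 'I_m.+1) : (i <= m)%N by rewrite -ltnS.
rewrite !pade_den_horner (_ : \sum_(i < m.+1) pade_weight m (- alpha) i =
  \sum_(i < m.+1) pade_weight m alpha i); last first.
  rewrite (revE (pade_weight m alpha)); apply: eq_bigr => i _.
  exact: pade_weightN.
rewrite ler_wpM2l//; first by rewrite invr_ge0 ltW// sum_pade_weight_gt0.
under eq_bigr do rewrite pade_weightN//.
have : 0 <= \sum_(i < m.+1)
    (pade_weight m alpha i - pade_weight m alpha (m - i)) *
    ((1 + x) ^+ i - (1 + x) ^+ (m - i)).
  apply: sumr_ge0 => i _; have x1 : 1 <= 1 + x by rewrite lerDl.
  have [le_mi|/ltnW le_mi] := leqP (m - i) i.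
    by rewrite mulr_ge0// subr_ge0 ?pade_weight_mono// ler_weXn2l.
  rewrite -mulrNN mulr_ge0// oppr_ge0 subr_le0 ?ler_weXn2l//.
  have := @pade_weight_mono m alpha (m - i) ha (leq_subr _ _).
  by rewrite subKn//; apply.
have -> : \sum_(i < m.+1)
    (pade_weight m alpha i - pade_weight m alpha (m - i)) *
    ((1 + x) ^+ i - (1 + x) ^+ (m - i)) =
  2 * (\sum_(i < m.+1) pade_weight m alpha i * (1 + x) ^+ i -
       \sum_(i < m.+1) pade_weight m alpha (m - i) * (1 + x) ^+ i).
  rewrite mulrDl mul1r.
  have E1 := revE (fun i => pade_weight m alpha i * (1 + x) ^+ i).
  have E2 := revE (fun i => pade_weight m alpha (m - i) * (1 + x) ^+ i).
  rewrite {1}E1 {1}E2 addrACA -!sumrN -!big_split/=; apply: eq_bigr => i _.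
  by rewrite subKn//; ring.
by rewrite pmulr_rge0// subr_ge0.
Qed.

(** Multiplying Q f - P by 1/f shows that P and Q exchange roles when alpha
    changes sign. *)
Lemma pade_explicit m alpha P Q : -1 < alpha < 1 -> alpha != 0 ->
  (size P <= m.+1)%N -> (size Q <= m.+1)%N -> Q.[0] = 1 ->
  ('X^((2 * m).+1) %| Q * binpoly (- alpha) (2 * m) - P)%R ->
  P = pade_den m (- alpha) /\ Q = pade_den m alpha.
Proof.
move=> ha a0 sP sQ Q0 QP; split; last exact: pade_den_uniq QP.
apply: (@pade_den_uniq _ _ _ Q) => //; rewrite ?oppr_eq0//; first by lra.
  have /dvdXnP/(_ 0%N isT) := QP; rewrite -horner_coef0 !hornerE binpoly_at0 Q0.
  by lra.
rewrite opprK; have -> : P * binpoly alpha (2 * m) - Q =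
    Q * (binpoly alpha (2 * m) * binpoly (- alpha) (2 * m) - 1) -
    binpoly alpha (2 * m) * (Q * binpoly (- alpha) (2 * m) - P) by ring.
by rewrite dvdp_sub ?dvdp_mull// binpoly_inv.
Qed.

(** The k-th derivative of p / Q is quot_num Q k p / Q^(k+1). *)
Fixpoint quot_num Q k p : {poly F} :=
  if k is j.+1 then (quot_num Q j p)^`() * Q - k%:R *: (quot_num Q j p * Q^`())
  else p.

Lemma quot_numB Q k p q : quot_num Q k (p - q) = quot_num Q k p - quot_num Q k q.
Proof.
by elim: k => //= k ->; rewrite derivB -!mul_polyC; ring.
Qed.

Lemma quot_numM Q k p : quot_num Q k (p * Q) = p^`(k) * Q ^+ k.+1.
Proof.
elim: k => [|k IHk]; first by rewrite expr1.
rewrite derivnS /= {}IHk derivM deriv_exp -!mul_polyC polyC_natr -mulr_natl/=.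
by rewrite [Q ^+ k.+2]exprS [Q ^+ k.+1]exprS; ring.
Qed.

(** Each differentiation of X^j h / Q lowers the order of vanishing by exactly
    one and multiplies the leading coefficient by the current order. *)
Lemma quot_num_XnM Q j h i : (i <= j)%N -> Q.[0] = 1 ->
  exists2 g, quot_num Q i ('X^j * h) = 'X^(j - i) * g & g.[0] = h.[0] *+ j ^_ i.
Proof.
move=> + Q0; elim: i => [_|i IHi lt_ij].
  by exists h; rewrite ?subn0 ?ffactn0.
have [g /= -> g0] := IHi (ltnW lt_ij).
exists ((j - i)%:R *: (g * Q) + 'X * (g^`() * Q - i.+1%:R *: (g * Q^`()))).
  rewrite derivM derivXn -mulr_natl -!mul_polyC !polyC_natr.
  by rewrite -(subnSK lt_ij) /= exprS; ring.
rewrite hornerD hornerZ !hornerM hornerX mul0r addr0 g0 Q0 mulr1.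
by rewrite ffactnSr mulrnA -[RHS]mulr_natl.
Qed.

(** If p vanished at 0 to an order j < n exactly, the j-th derivative of p / Q
    would be nonzero there. *)
Lemma quot_num_dvd Q n p : Q.[0] = 1 ->
  (forall k, (k < n)%N -> (quot_num Q k p).[0] = 0) -> ('X^n %| p)%R.
Proof.
move=> Q0; elim: n => [|n IHn] p0; first by rewrite dvd1p.
have /dvdpP[h ph] : ('X^n %| p)%R by apply: IHn => k /leqW/p0.
have := p0 n (ltnSn n); rewrite {}ph mulrC.
have [g -> g0] := quot_num_XnM h (leqnn n) Q0.
rewrite subnn expr0 mul1r g0 ffactnn => /eqP.
rewrite mulrn_eq0 -leqn0 leqNgt fact_gt0/= => /eqP h0.
have := dvdp_XsubCl h 0; rewrite subr0 /root h0 eqxx => Xh.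
by rewrite exprSr dvdp_mul2l ?expf_neq0 ?polyX_eq0.
Qed.

End pade_bounds.

(** * The error of one Pade step *)

Section pade_analysis.
Variable R : realType.
Implicit Types (s alpha delta x : R) (P Q : {poly R}).

Lemma is_derive_powR1D s x : 0 < 1 + x ->
  is_derive x 1 (fun y => (1 + y) `^ s) (s * (1 + x) `^ (s - 1)).
Proof.
move=> x1; apply: (@trigger_derive _ _ _ (s * (1 + x) `^ (s - 1) * (0 + 1))).
  apply: (@is_derive1_comp _ (fun z => z `^ s) (fun y => 1 + y)).
    exact: is_derive1_powR.
by rewrite add0r mulr1.
Qed.

Lemma MVT_from0 (f df : R -> R) x : 0 <= x ->
  (forall y : R, 0 <= y -> is_derive y 1 f (df y)) ->
  exists2 c, 0 <= c <= x & f x - f 0 = df c * x.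
Proof.
move=> x0 fdf; have [||c] := @MVT_segment R f df 0 x x0.
- by move=> y; rewrite in_itv/= => /andP[/ltW y0 _]; exact: fdf.
- apply: derivable_within_continuous => y; rewrite in_itv/= => /andP[y0 _].
  by have [] := fdf _ y0.
by rewrite in_itv/= => c0x ->; exists c => //; rewrite subr0.
Qed.

Lemma deriv_binpoly s n : (binpoly s n.+1)^`() = s *: binpoly (s - 1) n.
Proof.
apply/polyP => k; rewrite coef_deriv coefZ !coef_poly ltnS.
case: ifP => _; last by rewrite mul0rn mulr0.
rewrite big_ord_recl subr0.
rewrite (eq_bigr (fun l : 'I_k => s - 1 - l%:R)) => [|l _]; last first.
  by rewrite lift0 -natr1; ring.
have f0 : k`!%:R != 0 :> R by rewrite pnatr_eq0 -lt0n fact_gt0.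
by rewrite factS natrM -mulr_natr; field; rewrite f0 nat1r pnatr_eq0.
Qed.

Lemma powR1D_le1 s x : s <= 0 -> 0 <= x -> 0 <= (1 + x) `^ s <= 1.
Proof.
move=> s0 x0; rewrite powR_ge0/= -[leRHS](powRr0 (1 + x)).
by rewrite ler_powR// lerDl.
Qed.

(** Induction on n by the mean value theorem: the derivative of the remainder is
    s times the remainder of order n - 1 for the exponent s - 1. *)
Lemma powR_binpoly n s x : s <= 0 -> 0 <= x ->
  `|(1 + x) `^ s - (binpoly s n).[x]| <=
  (\prod_(l < n.+1) `|s - l%:R|) * x ^+ n.+1.
Proof.
elim: n s x => [|n IHn] s x s0 x0.
  have [c /andP[c0 cx]] := MVT_from0 x0
    (fun y (y0 : 0 <= y) => is_derive_powR1D s (ltr_wpDr y0 ltr01)).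
  rewrite addr0 powR1 => E.
  have -> : (binpoly s 0).[x] = 1.
    by rewrite /binpoly poly_def big_ord1 big_ord0 invr1 mulr1 scale1r hornerC.
  rewrite E big_ord1 subr0 !normrM expr1 (ger0_norm x0) ler_wpM2r//.
  have /andP[h0 h1] : 0 <= (1 + c) `^ (s - 1) <= 1 by apply: powR1D_le1; lra.
  by rewrite (ger0_norm h0) ler_piMr.
have [|c /andP[c0 cx]] := @MVT_from0
    (fun y => (1 + y) `^ s - (binpoly s n.+1).[y])
    (fun y => s * ((1 + y) `^ (s - 1) - (binpoly (s - 1) n).[y])) x x0.
  move=> y y0; apply: (@trigger_derive _ _ _
    (s * (1 + y) `^ (s - 1) - (binpoly s n.+1)^`().[y])).
    by apply: is_deriveB; apply: is_derive_powR1D; exact: ltr_wpDr.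
  by rewrite deriv_binpoly hornerZ mulrBr.
rewrite addr0 powR1 binpoly_at0 subrr subr0 => ->.
rewrite !normrM (ger0_norm x0) [x ^+ _]exprSr mulrA ler_wpM2r//.
rewrite big_ord_recl subr0 -mulrA ler_wpM2l//.
rewrite (eq_bigr (fun l : 'I_n.+1 => `|s - 1 - l%:R|)) => [|l _]; last first.
  by rewrite lift0 -natr1; congr `|_|; ring.
apply: le_trans (IHn _ _ _ c0) _; first by lra.
by rewrite ler_wpM2l ?prodr_ge0// lerXn2r ?nnegrE.
Qed.

Lemma derive1n_pade_error s P Q k x : 0 < 1 + x -> Q.[x] != 0 ->
  derive1n k (fun y => (1 + y) `^ s - P.[y] / Q.[y]) x =
  (\prod_(l < k) (s - l%:R)) * (1 + x) `^ (s - k%:R) -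
  (quot_num Q k P).[x] / Q.[x] ^+ k.+1.
Proof.
elim: k x => [|k IHk] x x1 Qx.
  by rewrite derive1n0 big_ord0 mul1r subr0 expr1.
rewrite derive1nS derive1E.
pose G y := (\prod_(l < k) (s - l%:R)) * (1 + y) `^ (s - k%:R) -
  (quot_num Q k P).[y] * (Q ^+ k.+1).[y]^-1.
rewrite (@near_eq_derive _ _ _ _ G); last first.
  have n1 : \forall y \near x, 0 < 1 + y.
    have /cvgrPdist_lt/(_ _ x1) : (fun y : R => y) y @[y --> x] --> x.
      exact: cvg_id.
    by apply: filterS => y /=; rewrite ltr_norml; lra.
  have n2 : \forall y \near x, Q.[y] != 0.
    have Q0 : 0 < `|Q.[x]| by rewrite normr_gt0.
    have /cvgrPdist_lt/(_ _ Q0) := @continuous_horner R Q x.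
    apply: filterS => y /=; apply: contraTneq => ->.
    by rewrite subr0 ltxx.
  near=> y; rewrite IHk ?/G ?horner_exp//; near: y; [exact: n1|exact: n2].
have Qk : (Q ^+ k.+1).[x] != 0 by rewrite horner_exp expf_neq0.
have DG : is_derive x 1 G
   ((\prod_(l < k) (s - l%:R)) *: ((s - k%:R) * (1 + x) `^ (s - k%:R - 1)) -
    ((quot_num Q k P).[x] *: (- (Q ^+ k.+1).[x] ^- 2 *: (Q ^+ k.+1)^`().[x]) +
     (Q ^+ k.+1).[x]^-1 *: (quot_num Q k P)^`().[x])).
  have D1 := is_derive_powR1D (s - k%:R) x1.
  have D2 : is_derive x 1 (fun y => (Q ^+ k.+1).[y]^-1)
      (- (Q ^+ k.+1).[x] ^- 2 *: (Q ^+ k.+1)^`().[x]) by exact: is_deriveV.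
  by apply: is_deriveB; apply: is_deriveM.
rewrite (@derive_val _ _ _ _ _ _ _ DG) big_ord_recr/= deriv_exp/=.
rewrite hornerD hornerN hornerZ hornerMn !hornerM !horner_exp /GRing.scale/=.
rewrite (_ : s - k.+1%:R = s - k%:R - 1); last by rewrite -natr1; ring.
by rewrite -[_ *+ k.+1]mulr_natl !exprS; field; rewrite expf_neq0 Qx.
Unshelve. all: by end_near. Qed.

(** The hypothesis on derivatives at 0 says that T Q - P, divided by Q, has
    vanishing derivatives up to order 2m, because T = binpoly and the power
    have the same ones; this turns the analytic condition into divisibility. *)
Lemma pade_dvd m alpha P Q : diagonal_pade m alpha P Q ->
  ('X^((2 * m).+1) %| Q * binpoly (- alpha) (2 * m) - P)%R.
Proof.
move=> [_ _ Q0 dF]; rewrite mulrC; apply: (quot_num_dvd Q0) => k.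
rewrite ltnS => le_k.
rewrite quot_numB quot_numM hornerD hornerN hornerM horner_exp Q0 expr1n mulr1.
have /eqP := dF k le_k; rewrite derive1n_pade_error ?Q0 ?addr0 ?oner_eq0//.
rewrite powR1 mulr1 expr1n divr1 subr_eq0 => /eqP <-.
rewrite horner_coef0 coef_derivn addn0 coef_poly ltnS le_k ffactnn.
by rewrite -[_ / _ *+ _]mulr_natr divfK ?subrr// pnatr_eq0 -lt0n fact_gt0.
Qed.

Lemma powR1D_decay alpha (X : R) : 0 < alpha -> 0 < X ->
  exists2 kappa, 0 < kappa & forall x, 0 <= x <= X ->
    kappa * x <= 1 - (1 + x) `^ (- alpha).
Proof.
move=> a0 X0; exists (alpha * (1 + X) `^ (- alpha - 1)).
  by rewrite mulr_gt0// powR_gt0//; lra.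
move=> x /andP[x0 xX].
have [c /andP[c0 cx]] := MVT_from0 x0
  (fun y (y0 : 0 <= y) => is_derive_powR1D (- alpha) (ltr_wpDr y0 ltr01)).
rewrite addr0 powR1 => E.
have -> : 1 - (1 + x) `^ (- alpha) = alpha * (1 + c) `^ (- alpha - 1) * x by lra.
rewrite ler_wpM2r// ler_wpM2l ?(ltW a0)//.
rewrite (_ : - alpha - 1 = - (alpha + 1)); last by ring.
rewrite !powRN lef_pV2 ?posrE ?powR_gt0; [|lra..].
by rewrite ge0_ler_powR ?nnegrE; lra.
Qed.

Lemma horner_norm_le (p : {poly R}) (X : R) :
  exists2 B, 0 <= B & forall x, 0 <= x <= X -> `|p.[x]| <= B.
Proof.
exists (\sum_(i < size p) `|p`_i| * `|X| ^+ i).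
  by rewrite sumr_ge0// => i _; rewrite mulr_ge0// exprn_ge0.
move=> x /andP[x0 xX]; rewrite horner_coef.
apply: le_trans (ler_norm_sum _ _ _) _; apply: ler_sum => i _.
rewrite normrM normrX ler_wpM2l// lerXn2r ?nnegrE//.
by rewrite !ger0_norm// (le_trans x0).
Qed.

(** The constant is uniform over P and Q because they are determined by m and
    alpha.  The error splits into the Taylor remainder of the power and the
    part X^(2m+1) | Q T - P; both are O(x^(2m+1)), and one factor x is traded
    for 1 - (1 + x)^-alpha. *)
Lemma pade_step m alpha (X : R) : 0 < alpha < 1 -> 0 < X ->
  exists2 K, 0 <= K & forall P Q, diagonal_pade m alpha P Q ->
    forall x, 0 <= x <= X -> [/\ 0 < Q.[x], 0 <= P.[x] / Q.[x] <= 1 &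
      `|(1 + x) `^ (- alpha) - P.[x] / Q.[x]| <=
        K * x ^+ (2 * m) * (1 - (1 + x) `^ (- alpha))].
Proof.
move=> ha X0; set P0 : {poly R} := pade_den m (- alpha).
set Q0 : {poly R} := pade_den m alpha.
have [a0 a1] : 0 < alpha /\ alpha < 1 by lra.
have [kappa kappa0 decay] := powR1D_decay a0 X0.
set T := binpoly (- alpha) (2 * m).
have [B B0 HB] := horner_norm_le ((Q0 * T - P0) %/ 'X^((2 * m).+1))%R X.
set C := \prod_(l < (2 * m).+1) `|- alpha - l%:R|.
have C0 : 0 <= C by rewrite prodr_ge0.
exists ((C + B) / kappa); first by rewrite divr_ge0 ?addr_ge0// ltW.
move=> P Q hPQ x /andP[x0 xX]; have dvd := pade_dvd hPQ.
case: hPQ => [sP sQ Q1 _].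
have [||||PE QE] := @pade_explicit _ m alpha P Q _ _ _ _ Q1 dvd;
  [lra|lra|by rewrite sP|by rewrite sQ|].
rewrite -/P0 in PE; rewrite -/Q0 in QE; rewrite PE QE in dvd *.
have Qge1 : 1 <= Q0.[x] by apply: pade_den_ge1; lra.
have Qgt0 : 0 < Q0.[x] by lra.
have Pge1 : 1 <= P0.[x] by apply: pade_den_ge1; lra.
have leP : P0.[x] <= Q0.[x] by apply: pade_den_le; lra.
split => //; first by rewrite divr_ge0 ?ler_pdivrMr ?mul1r; lra.
have sx : 0 <= x ^+ (2 * m) by rewrite exprn_ge0.
apply: (@le_trans _ _ ((C + B) * x ^+ (2 * m).+1)); last first.
  rewrite (_ : _ * x ^+ _ = (C + B) / kappa * x ^+ (2 * m) * (kappa * x)).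
    rewrite ler_wpM2l ?decay ?x0// mulr_ge0// divr_ge0 ?addr_ge0// ltW//.
  by rewrite exprSr; field; rewrite gt_eqF.
have QTP : Q0.[x] * T.[x] - P0.[x] =
    ((Q0 * T - P0) %/ 'X^((2 * m).+1)).[x] * x ^+ (2 * m).+1.
  have := congr1 (horner ^~ x) (divpK dvd); rewrite hornerM hornerXn => ->.
  by rewrite hornerD hornerN hornerM.
have -> : (1 + x) `^ (- alpha) - P0.[x] / Q0.[x] =
    ((1 + x) `^ (- alpha) - T.[x]) + (Q0.[x] * T.[x] - P0.[x]) / Q0.[x].
  by field; rewrite gt_eqF.
rewrite [leRHS]mulrDl (le_trans (ler_normD _ _))// lerD ?powR_binpoly//.
  by lra.
rewrite QTP normrM normfV (gtr0_norm Qgt0) ler_pdivrMr// normrM.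
rewrite (ger0_norm (exprn_ge0 _ x0)) -mulrA ler_pM// ?mulr_ge0 ?exprn_ge0//.
  by apply: HB; rewrite x0.
by rewrite ler_peMr ?exprn_ge0.
Qed.
End pade_analysis.

(** * The geometrically refined mesh and the scalar recurrence *)

Section refined_scalar.
Variable R : realType.
Implicit Types (alpha delta l : R) (P Q : {poly R}).

(** Invariants relate two runs at once: the operator run is compared with a
    scalar run, and a single run is the case of a trivial companion. *)
Lemma refined_run_rel (T T' : Type) (L N : nat)
    (step : nat -> nat -> T -> T) (step' : nat -> nat -> T' -> T')
    (I : nat -> nat -> T -> T' -> Prop) u0 u0' :
  I 0%N 0%N u0 u0' ->
  (forall n j u u', (n <= L)%N -> (j < N)%N -> I n j u u' ->
    I n j.+1 (step n j u) (step' n j u')) ->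
  (forall n u u', I n N u u' -> I n.+1 0%N u u') ->
  I L.+1 0%N (refined_run L N step u0) (refined_run L N step' u0').
Proof.
move=> I0 Istep Inext; rewrite /refined_run.
suff : forall n, (n <= L.+1)%N -> I n 0%N (iteri n (fun n => iteri N (step n)) u0)
    (iteri n (fun n => iteri N (step' n)) u0') by apply.
elim=> [//|n IHn] le_nL /=; apply: Inext.
suff : forall j, (j <= N)%N ->
  I n j (iteri j (step n) (iteri n (fun n => iteri N (step n)) u0))
        (iteri j (step' n) (iteri n (fun n => iteri N (step' n)) u0')) by apply.
by elim=> [_|j IHj lt_jN] /=; [apply/IHn/ltnW | apply/Istep/IHj/ltnW].
Qed.

Lemma mesh_tS L i : mesh_t L i.+1 = 2 ^+ i / 2 ^+ L :> R.
Proof.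
by rewrite /mesh_t /= intS [1 + _]addrC addrK expfzDr// exprnN.
Qed.

Lemma mesh_t_ge0 L i : 0 <= mesh_t L i :> R.
Proof. by case: i => [|i]; rewrite ?mesh_tS ?divr_ge0 ?exprn_ge0. Qed.

Lemma mesh_k_ge0 L N n : 0 <= mesh_k L N n :> R.
Proof. by rewrite /mesh_k; case: ifP => _; rewrite divr_ge0 ?mesh_t_ge0. Qed.

Lemma mesh_tj_ge0 L N n j : 0 <= mesh_tj L N n j :> R.
Proof. by rewrite addr_ge0 ?mesh_t_ge0// mulr_ge0 ?mesh_k_ge0. Qed.

Lemma mesh_tjN L N n : (0 < N)%N -> mesh_tj L N n N = mesh_t L n.+1 :> R.
Proof.
move=> N0; rewrite /mesh_tj /mesh_k mulrC divfK ?pnatr_eq0 -?lt0n//.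
case: n => [|n] /=; first by rewrite add0r.
by rewrite !mesh_tS exprS; ring.
Qed.

Lemma mesh_levels_ge lamM : 0 < lamM -> lamM <= 2 ^+ mesh_levels lamM :> R.
Proof.
move=> lam0; have ln2 : 0 < ln (2 : R) by rewrite ln_gt0// ltr1n.
rewrite -[leLHS]lnK ?posrE// -[leRHS]lnK ?posrE ?exprn_gt0// ler_expR lnXn//.
rewrite -[leRHS]mulr_natl -ler_pdivrMr// (le_trans (ceil_ge _))//.
by rewrite /mesh_levels natr_absz ger0_norm ?ler_int le_max lexx ?orbT.
Qed.

Definition mesh_step L N n j delta l : R :=
  mesh_k L N n * (l - delta) / (delta + mesh_tj L N n j * (l - delta)).

(** On the levels n >= 1 the denominator is at least t_n (l - delta), which gives
    1 / N.  On the level 0 it is at least delta, and l <= 2^L makes the numerator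
    at most 1 / N: this is what the choice of L is for. *)
Lemma mesh_step_bound L N n j delta l : (n <= L)%N -> (0 < N)%N ->
  0 < delta -> delta < l -> l <= 2 ^+ L ->
  0 <= mesh_step L N n j delta l <= (1 + delta^-1) / N%:R.
Proof.
move=> le_nL N0 d0 dl lL; have den0 : 0 < delta + mesh_tj L N n j * (l - delta).
  by rewrite ltr_pwDl// mulr_ge0 ?mesh_tj_ge0// subr_ge0 ltW.
have ld : 0 < l - delta by rewrite subr_gt0.
rewrite /mesh_step (divr_ge0 (mulr_ge0 (mesh_k_ge0 L N n) (ltW ld)) (ltW den0)).
have NR : 0 < N%:R :> R by rewrite ltr0n.
rewrite ler_pdivrMr// /mesh_k; case: n le_nL den0 => [|n] le_nL den0 /=.
  rewrite mesh_tS expr0 div1r.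
  apply: (@le_trans _ _ (N%:R^-1)).
    rewrite mulrAC ler_piMl ?invr_ge0 ?(ltW NR)//.
    by rewrite ler_pdivrMl ?exprn_gt0// mulr1; lra.
  rewrite -[leLHS]mul1r [leRHS]mulrAC ler_pM2r ?invr_gt0//.
  rewrite mulrDl mul1r [delta^-1 * _]mulrDr mulVf ?gt_eqF//.
  have := @mesh_tj_ge0 L N 0 j; have di : 0 < delta^-1 by rewrite invr_gt0.
  move: (mesh_tj _ _ _ _) => t t0.
  have h1 : 0 <= t * (l - delta) by rewrite mulr_ge0// ltW.
  have h2 : 0 <= delta^-1 * (t * (l - delta)) by rewrite mulr_ge0// ltW.
  lra.
rewrite mulrAC [leRHS]mulrAC ler_pM2r ?invr_gt0// mulrDl mul1r.
have kj : mesh_t L n.+1 <= mesh_tj L N n.+1 j :> R.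
  by rewrite lerDl mulr_ge0 ?mesh_k_ge0.
have h1 : mesh_t L n.+1 * (l - delta) <= mesh_tj L N n.+1 j * (l - delta).
  by rewrite ler_pM2r.
have h2 : 0 <= delta^-1 * (delta + mesh_tj L N n.+1 j * (l - delta)).
  by rewrite mulr_ge0 ?invr_ge0 ?ltW.
lra.
Qed.

(** The invariant |y - mu| <= E (y(0) - y) is stable: the new local error is at
    most E (1 - rho) y, exactly E times the decrease of y, and the old error is
    not amplified since 0 <= r <= 1. *)
Lemma scalar_recurrence_error m alpha delta : 0 < alpha < 1 -> 0 < delta ->
  exists2 c, 0 <= c & forall P Q, diagonal_pade m alpha P Q ->
    forall L N l, (0 < N)%N -> delta < l -> l <= 2 ^+ L ->
    (forall n j, (n <= L)%N -> 0 < Q.[mesh_step L N n j delta l]) /\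
    `|l `^ (- alpha) - scalar_recurrence alpha delta P Q L N l|
       <= c * N%:R ^- (2 * m).
Proof.
move=> ha d0; set X := 1 + delta^-1.
have X0 : 0 < X by rewrite ltr_pwDl ?invr_ge0 ?ltW.
have [K K0 HK] := pade_step m ha X0.
exists (K * X ^+ (2 * m) * delta `^ (- alpha)).
  by rewrite !mulr_ge0 ?exprn_ge0 ?powR_ge0 ?(ltW X0).
move=> P Q hPQ L N l N0 dl lL; have NR : 0 < N%:R :> R by rewrite ltr0n.
have N1 : 1 <= N%:R :> R by rewrite ler1n.
have step_le n j : (n <= L)%N ->
    0 <= mesh_step L N n j delta l <= X / N%:R.
  by move=> le_nL; exact: mesh_step_bound.
have step_leX n j : (n <= L)%N -> 0 <= mesh_step L N n j delta l <= X.
  move=> /(step_le _ j)/andP[-> /le_trans]; apply.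
  by rewrite ler_piMr ?(ltW X0)// invf_le1.
split=> [n j /(step_leX _ j)/(HK _ _ hPQ)[]//|].
pose y t := (delta + t * (l - delta)) `^ (- alpha).
have y1 : y 1 = l `^ (- alpha) by rewrite /y mul1r addrC subrK.
have y0 : y 0 = delta `^ (- alpha) by rewrite /y mul0r addr0.
set E := K * X ^+ (2 * m) * N%:R ^- (2 * m).
have E0 : 0 <= E by rewrite !mulr_ge0 ?invr_ge0 ?exprn_ge0 ?(ltW X0) ?(ltW NR).
suff : `|y 1 - scalar_recurrence alpha delta P Q L N l| <= E * (y 0 - y 1).
  rewrite y1 y0 => /le_trans; apply; rewrite [leRHS]mulrAC -/E ler_wpM2l//.
  by rewrite gerBl powR_ge0.
have t1 : mesh_tj L N L.+1 0 = 1 :> R.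
  by rewrite /mesh_tj mul0r addr0 mesh_tS divff// expf_neq0.
rewrite -{1 2}t1.
pose I n j mu (_ : unit) :=
  `|y (mesh_tj L N n j) - mu| <= E * (y 0 - y (mesh_tj L N n j)).
apply: (@refined_run_rel _ _ L N _ (fun _ _ => id) I _ tt).
- by rewrite /I /mesh_tj mul0r !addr0 /mesh_t/= y0 !subrr normr0 mulr0.
- move=> n j mu u le_nL lt_jN; rewrite /I {u} -/(mesh_step L N n j delta l).
  have := step_leX n j le_nL; have /andP[x0 xN] := step_le n j le_nL.
  have den0 : 0 < delta + mesh_tj L N n j * (l - delta).
    by rewrite ltr_pwDl// mulr_ge0 ?mesh_tj_ge0// subr_ge0 ltW.
  have yS : y (mesh_tj L N n j.+1) =
      (1 + mesh_step L N n j delta l) `^ (- alpha) * y (mesh_tj L N n j).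
    rewrite /y -powRM ?(ltW den0)//; last by rewrite addr_ge0.
    congr (_ `^ _).
    rewrite /mesh_step [RHS]mulrDl mul1r divfK ?gt_eqF// /mesh_tj -natr1; ring.
  move: (mesh_step _ _ _ _ _ _) x0 xN yS => x x0 xN -> /(HK _ _ hPQ)[Q0].
  set r := P.[x] / Q.[x]; set rho := (1 + x) `^ _ => /andP[r0 r1] err.
  set yt := y _ => IH.
  have yt0 : 0 <= yt by exact: powR_ge0.
  have rho1 : 0 <= 1 - rho.
    by rewrite subr_ge0; have /andP[] : 0 <= rho <= 1 by apply: powR1D_le1; lra.
  have -> : rho * yt - r * mu = (rho - r) * yt + r * (yt - mu) by ring.
  have -> : E * (y 0 - rho * yt) = E * (1 - rho) * yt + E * (y 0 - yt) by ring.
  apply: le_trans (ler_normD _ _) (lerD _ _); rewrite normrM.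
    rewrite (ger0_norm yt0) ler_wpM2r// (le_trans err)// ler_wpM2r//.
    by rewrite /E -mulrA ler_wpM2l// -expr_div_n lerXn2r ?nnegrE// divr_ge0// ltW.
  by rewrite (ger0_norm r0) (le_trans _ IH)// ler_piMl.
- move=> n mu u; rewrite /I {u} mesh_tjN//.
  by rewrite (_ : mesh_tj L N n.+1 0 = mesh_t L n.+1)// /mesh_tj mul0r addr0.
Qed.
End refined_scalar.

(** * Lebesgue square-integrable functions on an open set *)

Section open_measurable.
Variables (R : realType) (n : nat).

Definition rat_box (p : 'rV[rat]_n * nat) : set 'rV[R]_n :=
  \bigcap_(i : 'I_n)
    (@rV_coord R n i @^-1` ball (ratr (p.1 ord0 i) : R) p.2.+1%:R^-1).

Lemma measurable_rat_box p : measurable (rat_box p).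
Proof.
apply: fin_bigcap_measurable; first exact: finite_finset.
move=> i _; rewrite -[X in measurable X]setTI.
by apply: (measurable_rV_coord i) => //; exact: measurable_ball.
Qed.

(** The measurable sets are generated by the coordinates, so an open set is
    written as a countable union of rational boxes. *)
Lemma open_measurable_rV (A : set 'rV[R]_n) : open A -> measurable A.
Proof.
move=> oA; pose S := [set p | rat_box p `<=` A].
have -> : A = \bigcup_p (if p \in S then rat_box p else set0).
  apply/seteqP; split=> [x Ax|x [p _]]; last first.
    by case: ifPn => // /set_mem pS /pS.
  have /nbhs_ballP[e /= e0 eA] : nbhs x A by exact: open_nbhs_nbhs.
  have [k ke] : exists k, k.+1%:R^-1 + k.+1%:R^-1 < e.
    have [|k] := @ltr_add_invr R 0 (e / 2); first by lra.
    by rewrite add0r => ke; exists k; rewrite [ltRHS]splitr ltrD.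
  have approx (r y : R) : 0 < r -> exists q : rat, `|ratr q - y| < r.
    move=> r0; have [|q] := @rat_in_itvoo R y (y + r); first by lra.
    by rewrite in_itv/= => /andP[q1 q2]; exists q; rewrite ltr_norml; lra.
  have /choice[c xc] : forall i, exists q : rat,
      `|ratr q - x ord0 i| < k.+1%:R^-1.
    by move=> i; apply: approx; rewrite invr_gt0.
  exists (\row_i c i, k) => //; rewrite ifT; last first.
    apply/mem_set => y ybox; apply: eA; split=> // i j; rewrite (ord1 i).
    have := xc j; have := ybox j I; rewrite /= mxE /ball/= => yc xcj.
    rewrite -(subrKA (ratr (c j))) (le_lt_trans (ler_normD _ _))//.
    by rewrite (distrC (x _ _)) (lt_trans _ ke)// ltrD.
  move=> i _; rewrite /= mxE /ball/=; exact: xc.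
apply: countable_bigcupT_measurable; first exact: countableP.
by move=> p; case: ifP => _; [exact: measurable_rat_box | exact: measurable0].
Qed.
End open_measurable.

Section L2_inner_product.
Variables (R : realType) (d : nat) (Omega : set 'rV[R]_d.+1).
Hypothesis openO : open Omega.
Implicit Types f g : 'rV[R]_d.+1 -> R.

Lemma L2_integrableM f g : L2 Omega f -> L2 Omega g ->
  (lebesgue_rV d.+1).-integrable Omega (EFin \o (fun x => f x * g x)).
Proof.
move=> [mf if2] [mg ig2]; have mO := open_measurable_rV openO.
apply: (le_integrable _ _ _ (integrableD _ if2 ig2)) => //.
  by apply/measurable_EFinP; exact: measurable_funM.
move=> x Ox /=; rewrite lee_fin [leRHS]ger0_norm ?addr_ge0 ?sqr_ge0//.
move: (f x) (g x) => y z; have hD := sqr_ge0 (y + z); have hB := sqr_ge0 (y - z).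
by have hy := sqr_ge0 y; have hz := sqr_ge0 z; rewrite ler_norml; lra.
Qed.

Lemma L2dotC f g : L2dot Omega f g = L2dot Omega g f.
Proof. by apply: eq_Rintegral => x _; rewrite mulrC. Qed.

Lemma L2dot_linear (a : R) f g h : L2 Omega f -> L2 Omega g -> L2 Omega h ->
  L2dot Omega (fun x => a * f x + g x) h = a * L2dot Omega f h + L2dot Omega g h.
Proof.
move=> Lf Lg Lh; have mO := open_measurable_rV openO.
have ifh := L2_integrableM Lf Lh; have igh := L2_integrableM Lg Lh.
rewrite /L2dot -RintegralZl// -RintegralD//.
  by apply: eq_Rintegral => x _; rewrite mulrDl mulrA.
by apply: (integrableZl mO a ifh).
Qed.
End L2_inner_product.

(** * Operators diagonal in an orthonormal basis *)

Section spectral.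
Variables (R : realType) (V : vectType R) (M : nat) (psi : 'I_M.+1 -> V).
Variable ip : V -> V -> R.
Hypothesis ip_linear : forall a u v w, ip (a *: u + v) w = a * ip u w + ip v w.
Hypothesis ipC : forall u v, ip u v = ip v u.
Hypothesis dimV : \dim {:V} = M.+1.
Hypothesis ip_psi : forall i j, ip (psi i) (psi j) = (i == j)%:R.
Implicit Types (u v w : V) (f g : 'End(V)) (c : 'I_M.+1 -> R).

Lemma ip0 w : ip 0 w = 0.
Proof. by have := ip_linear (-1) 0 0 w; rewrite scaler0 addr0 mulN1r addNr. Qed.

Lemma ip_sum c w : ip (\sum_i c i *: psi i) w = \sum_i c i * ip (psi i) w.
Proof.
by elim/big_rec2: _ => [|i y u _ <-]; rewrite ?ip0 ?ip_linear.
Qed.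

Lemma ip_coef c j : ip (\sum_i c i *: psi i) (psi j) = c j.
Proof.
rewrite ip_sum (bigD1 j)//= ip_psi eqxx mulr1 big1 ?addr0// => i ij.
by rewrite ip_psi (negbTE ij) mulr0.
Qed.

Lemma ip_expand v : v = \sum_i ip v (psi i) *: psi i.
Proof.
pose X := [tuple psi i | i < M.+1].
have XE (i : 'I_M.+1) : X`_i = psi i by rewrite -tnth_nth tnth_mktuple.
have XB : basis_of fullv X.
  rewrite basisEfree subvf size_tuple dimV leqnn !andbT.
  apply/freeP => k; under eq_bigr do rewrite XE.
  by move=> k0 i; rewrite -(ip_coef k i) k0 ip0.
have := coord_basis XB (memvf v); under eq_bigr do rewrite XE.
by move=> vE; rewrite {1}vE; apply: eq_bigr => i _; rewrite {2}vE ip_coef.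
Qed.

Lemma ip_parseval v : ip v v = \sum_i ip v (psi i) ^+ 2.
Proof.
rewrite {1}[v]ip_expand ip_sum; apply: eq_bigr => i _.
by rewrite ipC expr2.
Qed.

Definition diagonal f c := forall i, f (psi i) = c i *: psi i.

Lemma diagonal_ip f c v i : diagonal f c -> ip (f v) (psi i) = c i * ip v (psi i).
Proof.
move=> fc; rewrite {1}[v]ip_expand linear_sum.
under eq_bigr do rewrite linearZ/= fc scalerA.
by rewrite ip_coef mulrC.
Qed.

Lemma diagonal1 : diagonal \1%VF (fun=> 1).
Proof. by move=> i; rewrite id_lfunE scale1r. Qed.

Lemma diagonalD f g c e : diagonal f c -> diagonal g e ->
  diagonal (f + g) (fun i => c i + e i).
Proof. by move=> fc ge i; rewrite add_lfunE fc ge scalerDl. Qed.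

Lemma diagonalZ a f c : diagonal f c -> diagonal (a *: f) (fun i => a * c i).
Proof. by move=> fc i; rewrite scale_lfunE fc scalerA. Qed.

Lemma diagonal_comp f g c e : diagonal f c -> diagonal g e ->
  diagonal (f \o g)%VF (fun i => c i * e i).
Proof.
by move=> fc ge i; rewrite comp_lfunE ge linearZ/= fc scalerA mulrC.
Qed.

Lemma diagonal_inv f c : (forall i, c i != 0) -> diagonal f c ->
  diagonal f^-1%VF (fun i => (c i)^-1).
Proof.
move=> c0 fc i; have f_inj : lker f == 0%VS.
  rewrite -subv0; apply/subvP => v; rewrite memv_ker memv0 => /eqP fv0.
  rewrite [v]ip_expand big1// => j _.
  have /eqP := diagonal_ip v j fc; rewrite fv0 ip0 eq_sym mulf_eq0.
  rewrite (negbTE (c0 j)).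
  by move=> /eqP ->; rewrite scale0r.
have E : psi i = f ((c i)^-1 *: psi i).
  by rewrite linearZ/= fc scalerA mulVf// scale1r.
by rewrite {1}E lker0_lfunK.
Qed.

Lemma diagonal_poly (p : {poly R}) f c : diagonal f c ->
  diagonal (\sum_(i < size p) p`_i *: iter i (comp_lfun f) \1%VF)
    (fun i => p.[c i]).
Proof.
move=> fc i; rewrite sum_lfunE horner_coef scaler_suml; apply: eq_bigr => k _.
rewrite scale_lfunE -scalerA; congr (_ *: _).
elim: (k : nat) => [|l IHl] /=; first by rewrite id_lfunE scale1r.
by rewrite comp_lfunE IHl linearZ/= fc scalerA exprSr.
Qed.

Lemma diagonal_rational (P Q : {poly R}) f c : (forall i, Q.[c i] != 0) ->
  diagonal f c -> diagonal (rational_op P Q f) (fun i => P.[c i] / Q.[c i]).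
Proof.
move=> Q0 fc; apply: diagonal_comp; first exact: diagonal_poly.
by apply: diagonal_inv => //; exact: diagonal_poly.
Qed.

End spectral.

(** * The error bound for the operator recurrence *)

Section spectral_recurrence.
Variables (R : realType) (V : vectType R) (M : nat) (psi : 'I_M.+1 -> V).
Variable ip : V -> V -> R.
Hypothesis ip_linear : forall a u v w, ip (a *: u + v) w = a * ip u w + ip v w.
Hypothesis ipC : forall u v, ip u v = ip v u.
Hypothesis dimV : \dim {:V} = M.+1.
Hypothesis ip_psi : forall i j, ip (psi i) (psi j) = (i == j)%:R.
Variables (Ah : 'End(V)) (lam : 'I_M.+1 -> R) (delta : R).
Hypothesis Ah_psi : diagonal psi Ah lam.
Hypothesis delta_gt0 : 0 < delta.
Hypothesis delta_lt : forall i, delta < lam i.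

Lemma diagonal_mesh_step L N n j (B := Ah - delta *: \1%VF) :
  diagonal psi (mesh_k L N n *: (B \o (delta *: \1 + mesh_tj L N n j *: B)^-1)%VF)
    (fun i => mesh_step L N n j delta (lam i)).
Proof.
have BE : diagonal psi B (fun i => lam i - delta).
  move=> i; rewrite add_lfunE opp_lfunE scale_lfunE id_lfunE Ah_psi.
  by rewrite scalerBl.
have DE := diagonalD (diagonalZ delta (diagonal1 psi))
  (diagonalZ (mesh_tj L N n j) BE).
have den_neq0 i : delta * 1 + mesh_tj L N n j * (lam i - delta) != 0.
  rewrite gt_eqF// mulr1 ltr_pwDl// mulr_ge0 ?mesh_tj_ge0//.
  by rewrite subr_ge0 ltW.
move=> i; have invE := diagonal_inv ip_linear dimV ip_psi den_neq0 DE.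
rewrite (diagonalZ (mesh_k L N n) (diagonal_comp BE invE)).
by rewrite mulr1 mulrA.
Qed.

(** A step is a rational function of Ah, hence diagonal: the coefficients on the
    eigenvectors are not mixed, and each undergoes its own scalar recurrence. *)
Lemma operator_recurrence_ip alpha (P Q : {poly R}) L N v i :
  (forall n j k, (n <= L)%N -> Q.[mesh_step L N n j delta (lam k)] != 0) ->
  ip (operator_recurrence Ah alpha delta P Q L N v) (psi i) =
  scalar_recurrence alpha delta P Q L N (lam i) * ip v (psi i).
Proof.
move=> Q0; pose I (_ _ : nat) U mu := ip U (psi i) = mu * ip v (psi i).
apply: (@refined_run_rel _ _ L N _ _ I).
- rewrite /I -[X in ip X _]addr0 ip_linear.
  by rewrite (ip0 ip_linear) addr0.
- move=> n j U mu le_nL _ IH; rewrite /I.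
  have step_diag := diagonal_rational ip_linear dimV ip_psi P
    (fun k => Q0 n j k le_nL) (@diagonal_mesh_step L N n j).
  by rewrite (diagonal_ip ip_linear dimV ip_psi _ _ step_diag) IH mulrA.
- by [].
Qed.

Lemma ip_norm_le C u v : 0 <= C ->
  (forall i, `|ip u (psi i)| <= C * `|ip v (psi i)|) ->
  Num.sqrt (ip u u) <= C * Num.sqrt (ip v v).
Proof.
move=> C0 uv; rewrite -[X in X * _](ger0_norm C0) -sqrtr_sqr -sqrtrM ?sqr_ge0//.
rewrite ler_wsqrtr// !(ip_parseval ip_linear ipC dimV ip_psi) mulr_sumr.
apply: ler_sum => i _; rewrite -real_normK ?num_real//.
rewrite -[X in _ * X]real_normK ?num_real//.
by rewrite -exprMn lerXn2r ?nnegrE ?mulr_ge0.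
Qed.

End spectral_recurrence.

Theorem theorem3p3 (R : realType) (m : nat) (alpha delta : R)
    (hm : (1 <= m)%N) (halpha : 0 < alpha < 1) (hdelta : 0 < delta) :
  exists c : R,
    forall (P Q : {poly R}) (hPQ : diagonal_pade m alpha P Q)
      (d : nat) (Omega : set 'rV[R]_d.+1)
      (hOmega : bounded_lipschitz_domain Omega)
      (a : 'rV[R]_d.+1 -> 'M[R]_d.+1) (q : 'rV[R]_d.+1 -> R)
      (hsym : symmetric_coef Omega a) (hmeas : measurable_coef Omega a q)
      (hbounded : bounded_form Omega a q)
      (hcoercive : coercive_form Omega a q)
      (Vh : vectType R) (iota : {linear Vh -> ('rV[R]_d.+1 -> R^o)})
      (hVh : subspace_of_H10 Omega iota)
      (Ah : 'End(Vh)) (hAh : discrete_operator Omega iota a q Ah)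
      (M : nat) (lam : 'I_M.+1 -> R) (psi : 'I_M.+1 -> Vh)
      (heig : eigensystem Omega iota Ah lam psi)
      (hdelta1 : delta < lam ord0)
      (N : nat) (hN : (0 < N)%N),
    let L := mesh_levels (lam ord_max) in
    (forall l : R, lam ord0 <= l <= lam ord_max ->
       `|l `^ (- alpha) - scalar_recurrence alpha delta P Q L N l|
         <= c * N%:R ^- (2 * m)) /\
    (forall v : Vh,
       hnorm Omega iota (fractional_power Omega iota lam psi (- alpha) v
                         - operator_recurrence Ah alpha delta P Q L N v)
         <= c * N%:R ^- (2 * m) * hnorm Omega iota v).
Proof.
have [c c_ge0 scalar_err] := scalar_recurrence_error m halpha hdelta.
exists c => P Q hPQ d Omega [_ openO _ _ _] a q _ _ _ _ Vh iota [iotaH10 _].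
move=> Ah _ M lam psi [dimV lam_mono Ah_psi hdot_psi] delta_lt N N_gt0 L.
have delta_lam i : delta < lam i by rewrite (lt_le_trans delta_lt)// lam_mono.
have lam_le i : lam i <= lam ord_max by rewrite lam_mono// -ltnS.
have lam_max : lam ord_max <= 2 ^+ L.
  exact/mesh_levels_ge/(lt_trans hdelta).
have iotaL2 v : L2 Omega (iota v) by have [[]] := iotaH10 v.
pose ip := hdot Omega iota.
have ipC u v : ip u v = ip v u by exact: L2dotC.
have ip_linear b u v w : ip (b *: u + v) w = b * ip u w + ip v w.
  rewrite -(L2dot_linear openO b (iotaL2 u) (iotaL2 v) (iotaL2 w)).
  by rewrite /ip /hdot linearP.
split=> [l /andP[l0 lM]|v].
  have [_ ->//] := scalar_err P Q hPQ L N l N_gt0 (lt_le_trans delta_lt l0)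
    (le_trans lM lam_max).
have scalar_lam i := scalar_err P Q hPQ L N (lam i) N_gt0 (delta_lam i)
  (le_trans (lam_le i) lam_max).
apply: (ip_norm_le ip_linear ipC dimV hdot_psi).
  by rewrite mulr_ge0// invr_ge0 exprn_ge0.
move=> i; have [_ err] := scalar_lam i.
rewrite addrC -scaleN1r ip_linear mulN1r addrC.
rewrite /fractional_power (ip_coef ip_linear hdot_psi).
rewrite (operator_recurrence_ip ip_linear dimV hdot_psi Ah_psi)//; last first.
  by move=> n j k le_nL; rewrite gt_eqF//; have [-> ] := scalar_lam k.
by rewrite -mulrBl normrM ler_wpM2r.
Qed.
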